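(* For any integer $k \geq 2$, there exists a finite simple graph $G$ such that $\alpha(G)=\gamma^\infty(G)=\theta(G)=\binom{k+1}{2}+1$ and $\alpha(G \Box K_2)=\gamma^\infty(G \Box K_2)<\theta(G \Box K_2)$.
   Context: All graphs are finite and simple. For a graph $G$, $\alpha(G)$ is the independence number (maximum cardinality of a set of pairwise non-adjacent vertices). A clique is a set of pairwise adjacent vertices; a clique cover of $G$ is a set $\{X_1,\ldots,X_k\}$ of cliques with $\bigcup_{i=1}^k X_i = V(G)$; $\theta(G)$, the clique cover number, is the minimum cardinality of a clique cover of $G$. A set $X \subseteq V(G)$ is dominating if every $u \in V(G)\setminus X$ is adjacent to some $x \in X$. Eternal domination: a set of guards begins by occupying a dominating set $X$ of $G$ (one guard per vertex of $X$) and must respond to an infinite sequence of attacks. When an attacker chooses a vertex $u$ not currently occupied by a guard, one guard located at a vertex adjacent to $u$ must move to $u$ (all other guards stay in place), and the resulting set of occupied vertices must again be a dominating set of $G$. If $k$ guards, from some initial placement, can respond in this way to any infinite sequence of attacks, then $G$ can be eternally $k$-guarded. The eternal domination number $\gamma^\infty(G)$ is the minimum $k$ for which $G$ can be eternally $k$-guarded. The Cartesian product $G \Box H$ has vertex set $V(G)\times V(H)$, with $(u,v)$ and $(x,y)$ adjacent if and only if either $u=x$ and $vy\in E(H)$, or $v=y$ and $ux \in E(G)$. $K_2$ is the complete graph on two vertices. *)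

(* Defs.v *)
From mathcomp Require Import all_boot.
From mathcomp.classical Require Import boolp.

Set Implicit Arguments.
Unset Strict Implicit.
Unset Printing Implicit Defensive.

Record sgraph := SGraph {
  vertex :> finType;
  adj : rel vertex;
  adj_sym : symmetric adj;
  adj_irrefl : irreflexive adj
}.

Definition complete_rel n : rel 'I_n := fun i j => i != j.

Lemma complete_rel_sym n : symmetric (@complete_rel n).
Proof. by move=> i j; rewrite /complete_rel eq_sym. Qed.

Lemma complete_rel_irrefl n : irreflexive (@complete_rel n).
Proof. by move=> i; rewrite /complete_rel eqxx. Qed.

Definition complete n := SGraph (@complete_rel_sym n) (@complete_rel_irrefl n).

Section CartesianProduct.
Variables G H : sgraph.

Definition cartesian_rel : rel (G * H)%type := fun p q =>
  (p.1 == q.1) && adj p.2 q.2 || (p.2 == q.2) && adj p.1 q.1.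

Lemma cartesian_rel_sym : symmetric cartesian_rel.
Proof.
move=> p q.
by rewrite /cartesian_rel (eq_sym p.1) (eq_sym p.2) (adj_sym p.1) (adj_sym p.2).
Qed.

Lemma cartesian_rel_irrefl : irreflexive cartesian_rel.
Proof. by move=> p; rewrite /cartesian_rel !adj_irrefl !andbF. Qed.

Definition cartesian := SGraph cartesian_rel_sym cartesian_rel_irrefl.

End CartesianProduct.

Section Invariants.
Variable G : sgraph.

Definition independent (S : {set G}) :=
  [forall x in S, forall y in S, ~~ adj x y].

Definition independence_number := \max_(S : {set G} | independent S) #|S|.

Definition clique (X : {set G}) :=
  [forall x in X, forall y in X, (x != y) ==> adj x y].

Definition clique_cover (P : {set {set G}}) :=
  [forall X in P, clique X] && (cover P == [set: G]).

Lemma clique_cover_exists :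
  exists k, [exists P : {set {set G}}, clique_cover P && (#|P| == k)].
Proof.
exists #|[set [set x] | x : G]|; apply/existsP; exists [set [set x] | x : G].
rewrite eqxx andbT; apply/andP; split.
  apply/forall_inP => _ /imsetP[z _ ->].
  apply/forall_inP => x /set1P ->; apply/forall_inP => y /set1P ->.
  by rewrite eqxx.
apply/eqP/setP => x; rewrite in_setT; apply/bigcupP.
by exists [set x]; rewrite ?set11 ?imset_f.
Qed.

Definition clique_cover_number := ex_minn clique_cover_exists.

Definition dominating (X : {set G}) :=
  [forall u in ~: X, exists x in X, adj u x].

(* A strategy names the vertex whose guard answers an attack, given the list of
   earlier attacks (oldest first) and the attacked vertex. *)
Definition strategy := seq G -> G -> G.

(* Vertices occupied after the first [n] attacks of [a].  Only unoccupied
   vertices can be attacked, so the entries [a i] that are occupied at time [i]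
   are skipped: no guard moves. *)
Fixpoint occupied (s : strategy) (X : {set G}) (a : nat -> G) n : {set G} :=
  if n is m.+1 then
    let D := occupied s X a m in
    if a m \in D then D else a m |: (D :\ s (mkseq a m) (a m))
  else X.

Definition guards_eternally (s : strategy) (X : {set G}) :=
  forall (a : nat -> G) n,
    dominating (occupied s X a n) /\
    (a n \notin occupied s X a n ->
     s (mkseq a n) (a n) \in occupied s X a n /\
     adj (s (mkseq a n) (a n)) (a n)).

Definition eternally_guarded k :=
  exists (X : {set G}) (s : strategy), #|X| = k /\ guards_eternally s X.

Lemma eternally_guarded_exists : exists k, `[< eternally_guarded k >].
Proof.
exists #|[set: G]|; apply/asboolP; exists setT, (fun _ u => u); split=> // a n.
have -> : occupied (fun _ u => u) setT a n = setT.
  by elim: n => //= n ->; rewrite in_setT.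
rewrite in_setT; split=> //.
by apply/forall_inP => u; rewrite setCT in_set0.
Qed.

Definition eternal_domination_number := ex_minn eternally_guarded_exists.

End Invariants.

(* Main.v *)
(* Let H be the graph below on ten vertices: theta(H) = 4, but three guards
   suffice on H, since from every dominating set of size three any attack can be
   answered so as to reach another one.  It has disjoint independent triples
   s1, s2, s3 with s1 and s2 avoiding the vertex 8.  Hang a new vertex x at 8.
   Then alpha = theta = 4 for the resulting graph, while in its prism three
   guards on each copy of H and one on the edge above x suffice, and s1 and x in
   one layer with s2 in the other are seven independent vertices.  If seven
   cliques covered the prism, each of them would meet each independent set of
   size seven exactly once.  Moving x between the layers, and replacing s2 by s3,
   shows that no clique of the cover joins x to H in the first layer, and that
   every clique meeting the first layer of H contains exactly one vertex of s1
   there, so that three cliques would cover H.  Isolated vertices, which raise all the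
   parameters of the graph and of its prism by one, give the larger values. *)
Require Import Defs.
From mathcomp Require Import all_boot.
From mathcomp.classical Require Import boolp.

Set Implicit Arguments.
Unset Strict Implicit.
Unset Printing Implicit Defensive.

(** * Independent sets, eternal guarding and clique covers *)

Section EternalDomination.
Variable G : sgraph.

Lemma independentP (S : {set G}) :
  reflect {in S &, forall x y, ~~ adj x y} (independent S).
Proof.
apply: (iffP forall_inP) => [indS x y xS yS|indS x xS].
  by move/forall_inP: (indS x xS); apply.
by apply/forall_inP => y; apply: indS.
Qed.

Lemma cliqueP (X : {set G}) :
  reflect {in X &, forall x y, x != y -> adj x y} (clique X).
Proof.
apply: (iffP forall_inP) => [clX x y xX yX|clX x xX].
  by move/forall_inP: (clX x xX) => /(_ y yX)/implyP.
by apply/forall_inP => y yX; apply/implyP; apply: clX.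
Qed.

Lemma independent_clique_eq (S X : {set G}) x y :
  independent S -> clique X -> x \in S -> y \in S -> x \in X -> y \in X -> x = y.
Proof.
move=> /independentP indS /cliqueP clX xS yS xX yX.
by apply/eqP/contraT => xy; move: (indS x y xS yS); rewrite clX.
Qed.

Lemma independent_le (S : {set G}) :
  independent S -> #|S| <= independence_number G.
Proof. by move=> indS; apply: (leq_bigmax_cond (F := fun S : {set G} => #|S|)). Qed.

(* Attack the vertices of an independent set one by one: a guard that has
   reached the set has no neighbour in it, so it never answers again. *)
Lemma independence_number_le k :
  eternally_guarded G k -> independence_number G <= k.
Proof.
move=> [X [s [<- guards]]]; apply/bigmax_leqP => S /independentP indS.
have [->|[x0 x0S]] := set_0Vmem S; first by rewrite cards0.
(* The default [x0] lies in [S], so the attacks past the end of the enumeration stay in [S] too. *)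
pose a i := nth x0 (enum S) i.
have aS i : a i \in S.
  rewrite /a; have [lt_i|le_i] := ltnP i (size (enum S)).
    by rewrite -mem_enum mem_nth.
  by rewrite nth_default.
have cardD n : #|occupied s X a n| = #|X|.
  elim: n => //= n IHn; case: ifP => // /negbT out.
  have [_ /(_ out)[sD _]] := guards a n.
  rewrite cardsU1 !inE negb_and out orbT -IHn.
  by rewrite (cardsD1 (s (mkseq a n) (a n)) (occupied s X a n)) sD.
have reached n i : i < n -> a i \in occupied s X a n.
  elim: n => // n IHn; rewrite ltnS leq_eqVlt => /predU1P[->|lt_in] /=.
    by case: ifP => // _; rewrite setU11.
  case: ifP => [_|/negbT out]; first exact: IHn.
  have [_ /(_ out)[_ adj_s]] := guards a n.
  rewrite !inE IHn // andbT; apply/orP; right.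
  apply/eqP => eq_a; move: adj_s; rewrite -eq_a.
  exact/negP/indS.
rewrite -(cardD #|S|); apply/subset_leq_card/subsetP => x xS.
rewrite -(nth_index x0 (s := enum S) (x := x)) ?mem_enum //.
by apply: reached; rewrite cardE index_mem mem_enum.
Qed.

Lemma eternal_domination_numberP :
  eternally_guarded G (eternal_domination_number G).
Proof. by rewrite /eternal_domination_number; case: ex_minnP => k /asboolP. Qed.

Lemma eternal_domination_number_le k :
  eternally_guarded G k -> eternal_domination_number G <= k.
Proof.
rewrite /eternal_domination_number; case: ex_minnP => m _ min_m guarded.
exact/min_m/asboolP.
Qed.

Lemma independence_le_eternal :
  independence_number G <= eternal_domination_number G.
Proof. exact/independence_number_le/eternal_domination_numberP. Qed.

Lemma clique_cover_numberP :
  exists2 P : {set {set G}}, clique_cover P & #|P| = clique_cover_number G.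
Proof.
rewrite /clique_cover_number; case: ex_minnP => k /existsP[P /andP[coverP /eqP <-]] _.
by exists P.
Qed.

Lemma clique_cover_number_le (P : {set {set G}}) :
  clique_cover P -> clique_cover_number G <= #|P|.
Proof.
move=> coverP; rewrite /clique_cover_number; case: ex_minnP => m _; apply.
by apply/existsP; exists P; rewrite coverP eqxx.
Qed.

Lemma clique_cover_choice (P : {set {set G}}) :
  clique_cover P -> exists c : G -> {set G}, forall v, c v \in P /\ v \in c v.
Proof.
case/andP=> _ /eqP coverT.
suff /choice[c cP] : forall v : G, exists X, X \in P /\ v \in X by exists c.
move=> v; have : v \in cover P by rewrite coverT inE.
by case/bigcupP => X XP vX; exists X.
Qed.

Lemma clique_cover_clique (P : {set {set G}}) X :
  clique_cover P -> X \in P -> clique X.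
Proof. by case/andP=> /forall_inP + _; apply. Qed.

Lemma independent_choice_inj (P : {set {set G}}) (S : {set G}) (c : G -> {set G}) :
  clique_cover P -> independent S -> (forall v, c v \in P /\ v \in c v) ->
  {in S &, injective c}.
Proof.
move=> coverP indS cP x y xS yS eq_c; have [cxP xc] := cP x.
apply: (independent_clique_eq indS (clique_cover_clique coverP cxP)) => //.
by rewrite eq_c; case: (cP y).
Qed.

Lemma independent_le_cover (S : {set G}) :
  independent S -> #|S| <= clique_cover_number G.
Proof.
move=> indS; have [P coverP <-] := clique_cover_numberP.
have [c cP] := clique_cover_choice coverP.
rewrite -(card_in_imset (independent_choice_inj coverP indS cP)).
by apply/subset_leq_card/subsetP => _ /imsetP[v _ ->]; case: (cP v).
Qed.

(** Sending each vertex of [W] to a chosen clique through it is injective, hence a bijection onto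
    [P] when [P] has no more elements than [W]. *)
Lemma tight_cover (P : {set {set G}}) (W : {set G}) :
  clique_cover P -> independent W -> #|P| <= #|W| ->
  (forall X, X \in P -> exists2 w, w \in W & w \in X) /\
  (forall X Y w, X \in P -> Y \in P -> w \in W -> w \in X -> w \in Y -> X = Y).
Proof.
move=> coverP indW le_PW; have [c cP] := clique_cover_choice coverP.
have c_inj := independent_choice_inj coverP indW cP.
have imP : c @: W = P.
  apply/eqP; rewrite eqEcard card_in_imset // le_PW andbT.
  by apply/subsetP => _ /imsetP[v _ ->]; case: (cP v).
have back X w : X \in P -> w \in W -> w \in X -> X = c w.
  move=> XP wW wX; have clX := clique_cover_clique coverP XP.
  move: XP; rewrite -imP => /imsetP[w' w'W eqX].
  suff -> : w = w' by [].
  apply: (independent_clique_eq indW clX) => //.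
  by rewrite eqX; case: (cP w').
split=> [X|X Y w XP YP wW wX wY]; last by rewrite (back X w) // (back Y w).
by rewrite -imP => /imsetP[w wW ->]; exists w => //; case: (cP w).
Qed.

(** * Guarding a graph piece by piece *)

(* [k] guards confined to [A] can answer forever the attacks on vertices of [A];
   the predicate [P] describes the positions they go through. *)
Definition guardable (A : {set G}) k :=
  exists (P : {set G} -> Prop) (X : {set G}), [/\ P X, #|X| = k &
    forall D, P D -> D \subset A /\
      forall u, u \in A :\: D ->
        exists v, [/\ v \in D, adj v u & P (u |: D :\ v)]].

(** A strategy sees only past attacks, so the current position is recomputed by folding over them.
    Domination comes for free: the guard that would answer an attack on [u] is a neighbour of
    [u]. *)
Lemma guardable_eternally_guarded k :
  guardable [set: G] k -> eternally_guarded G k.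
Proof.
move=> [P [X [PX <- step]]].
pose answer (D : {set G}) u :=
  odflt u [pick v in D | adj v u && `[< P (u |: D :\ v) >]].
have answerP D u : P D -> u \notin D ->
    [/\ answer D u \in D, adj (answer D u) u & P (u |: D :\ answer D u)].
  move=> PD out; rewrite /answer; case: pickP => [v /and3P[? ? /asboolP]|] //=.
  have [_ /(_ u)] := step D PD; rewrite !inE out => /(_ isT)[v [vD vu PD']].
  by move/(_ v); rewrite vD vu /=; move/asboolPn.
pose move_to (D : {set G}) u := if u \in D then D else u |: D :\ answer D u.
exists X, (fun h u => answer (foldl move_to X h) u); split=> // a n.
have occE m : occupied (fun h u => answer (foldl move_to X h) u) X a m
    = foldl move_to X (mkseq a m).
  by elim: m => // m IHm; rewrite mkseqS foldl_rcons /= IHm.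
have POcc m : P (foldl move_to X (mkseq a m)).
  elim: m => // m PD; rewrite mkseqS foldl_rcons /move_to -/move_to.
  by case: ifP => // /negbT out; case: (answerP _ _ PD out).
rewrite occE; split; last by move=> out; case: (answerP _ _ (POcc n) out).
apply/forall_inP => u; rewrite inE => out.
have [vD vu _] := answerP _ _ (POcc n) out.
by apply/exists_inP; exists (answer (foldl move_to X (mkseq a n)) u); rewrite // adj_sym.
Qed.

(** One guard walks inside the clique. The boolean, read as a number, assigns no guard to an empty
    one. *)
Lemma guardable_clique (X : {set G}) : clique X -> guardable X (X != set0).
Proof.
move/cliqueP=> clX; have [->|[x xX]] := set_0Vmem X.
  exists (fun D => D = set0), set0; rewrite eqxx cards0; split=> // D ->.
  by split=> // u; rewrite !inE.
have -> : X != set0 by apply/set0Pn; exists x.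
exists (fun D => exists2 v, v \in X & D = [set v]), [set x].
rewrite cards1; split=> //; first by exists x.
move=> _ [v vX ->]; rewrite sub1set; split=> // u.
rewrite !inE => /andP[uv uX]; exists v; rewrite inE eqxx; split=> //.
  by apply: clX => //; rewrite eq_sym.
by exists u => //; rewrite setDv setU0.
Qed.

(** The fibers are guarded independently: an attack is answered inside the fiber of its vertex, and
    the positions in the other fibers do not change. *)
Lemma eternal_domination_number_fibers (T : finType) (f : G -> T) (k : T -> nat) :
  (forall t, guardable [set v | f v == t] (k t)) ->
  eternal_domination_number G <= \sum_t k t.
Proof.
move=> /choice[P /choice[X PX]]; apply: eternal_domination_number_le.
apply: guardable_eternally_guarded.
have Xf t v : v \in X t -> f v = t.
  have [PXt _ /(_ _ PXt)[/subsetP sub _]] := PX t.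
  by move=> /sub; rewrite inE => /eqP.
have XE t : [set v in [set v | v \in X (f v)] | f v == t] = X t.
  apply/setP => v; rewrite !inE.
  by apply/andP/idP => [[+ /eqP <-]|vX] //; rewrite (Xf t v vX).
exists (fun D : {set G} => forall t, P t [set v in D | f v == t]), [set v | v \in X (f v)].
split=> [t||D PD].
- by rewrite XE; case: (PX t).
- rewrite -sum1_card (partition_big f predT) //=; apply: eq_bigr => t _.
  case: (PX t) => _ <- _; rewrite -[in RHS](XE t) -sum1_card.
  by apply: eq_bigl => v; rewrite !inE.
split=> [|u]; first exact: subsetT.
rewrite !inE andbT => out.
have [_ _ /(_ _ (PD (f u)))[_ /(_ u)]] := PX (f u).
rewrite !inE eqxx (negbTE out) => /(_ isT)[v []].
rewrite !inE => /andP[vD /eqP fv] vu Pv; exists v; split=> // t.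
have [<-|ne_t] := eqVneq (f u) t.
  congr (P _ _): Pv; apply/setP => w; rewrite !inE.
  by have [->|] := eqVneq w u; rewrite ?eqxx //= andbA.
congr (P _ _): (PD t); apply/setP => w; rewrite !inE.
have [->|_] := eqVneq w u; first by rewrite (negbTE ne_t) (negbTE out).
by have [->|_] := eqVneq w v; rewrite // fv (negbTE ne_t) andbF.
Qed.

Lemma clique_cover_number_fibers (T : finType) (f : G -> T) :
  (forall t, clique [set v | f v == t]) -> clique_cover_number G <= #|T|.
Proof.
move=> clf; pose P := [set [set v | f v == t] | t : T].
apply: leq_trans (clique_cover_number_le (P := P) _) (leq_imset_card _ _).
apply/andP; split; first by apply/forall_inP => _ /imsetP[t _ ->].
apply/eqP/setP => v; rewrite inE; apply/bigcupP.
by exists [set w | f w == f v]; rewrite ?imset_f ?inE.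
Qed.

Lemma eternal_domination_number_clique_fibers (T : finType) (f : G -> T) :
  (forall t, clique [set v | f v == t]) -> eternal_domination_number G <= #|T|.
Proof.
move=> clf; apply: leq_trans
  (eternal_domination_number_fibers (fun t => guardable_clique (clf t))) _.
by rewrite -sum1_card; apply: leq_sum => t _; apply: leq_b1.
Qed.

End EternalDomination.

Lemma guardable_imset (G G' : sgraph) (e : G -> G') k :
  injective e -> {homo e : u v / adj u v} ->
  guardable [set: G] k -> guardable (e @: [set: G]) k.
Proof.
move=> e_inj e_adj [P [X [PX <- step]]].
exists (fun D => exists2 D0, P D0 & D = e @: D0), (e @: X).
rewrite card_imset //; split=> //; first by exists X.
move=> _ [D PD ->]; split; first exact/imsetS/subsetT.
move=> _ /setDP[/imsetP[u _ ->]]; rewrite mem_imset // => out.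
have [_ /(_ u)] := step D PD; rewrite !inE out => /(_ isT)[v [vD vu PD']].
exists (e v); rewrite mem_imset //; split=> //; first exact: e_adj.
exists (u |: D :\ v) => //; apply/setP => w; rewrite !inE.
apply/idP/imsetP => [|[w' + ->]].
  case/predU1P=> [->|/andP[wv /imsetP[w' w'D eqw]]].
    by exists u; rewrite ?setU11.
  exists w' => //; rewrite !inE w'D andbT; apply/orP; right.
  by apply: contraNneq wv => <-; rewrite eqw.
by rewrite !inE (inj_eq e_inj) (inj_eq e_inj) mem_imset.
Qed.

(** * The core graph on ten vertices *)

(* Row [i] lists the vertices not adjacent to [i].  This is, up to one edge,
   the complement of a 4-critical graph; it was found by computer search. *)
Definition coneighbours : seq (seq nat) :=
  [:: [:: 1; 3; 8; 9]; [:: 0; 2; 4; 8]; [:: 1; 4; 5; 7]; [:: 0; 4; 6; 9];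
      [:: 1; 2; 3; 6]; [:: 2; 7; 9]; [:: 3; 4; 7; 8]; [:: 2; 5; 6; 8];
      [:: 0; 1; 6; 7]; [:: 0; 3; 5]].

Definition coadj i j := j \in nth [::] coneighbours i.

Definition core_rel : rel 'I_10 := fun i j => (i != j) && ~~ coadj i j.

Lemma core_sym : symmetric core_rel.
Proof.
have coadj_sym : all (fun i => all (fun j => coadj i j == coadj j i) (iota 0 10))
  (iota 0 10) by [].
move=> i j; rewrite /core_rel eq_sym; congr (_ && ~~ _); apply/eqP.
by apply: (allP (allP coadj_sym _ _)); rewrite mem_iota /=.
Qed.

Lemma core_irrefl : irreflexive core_rel.
Proof. by move=> i; rewrite /core_rel eqxx. Qed.

Definition core := SGraph core_sym core_irrefl.

Local Notation v i := (@Ordinal 10 i isT : vertex core).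

Lemma third_value (T : finType) (S : {set T}) a b c d :
  #|S| <= 3 -> a \in S -> b \in S -> c \in S -> d \in S ->
  a != b -> a != c -> b != c -> d != a -> d != b -> d = c.
Proof.
move=> cardS aS bS cS dS ab ac bc da db; apply/eqP; apply: contraTT cardS => dc.
rewrite -ltnNge; have <- : #|[:: a; b; c; d]| = 4.
  apply/card_uniqP; rewrite /= !inE !negb_or ab ac bc.
  by rewrite !(eq_sym _ d) da db dc.
apply/subset_leq_card/subsetP => x; rewrite !inE.
by case/or4P => /eqP ->.
Qed.

(* A map with clique fibers is a proper colouring of the complement, in which
   018 is a triangle; the colour of 2 then forces those of all the others. *)
Lemma core_not_3_coverable (T : finType) (S : {set T}) (f : core -> T) :
  #|S| <= 3 -> (forall x, f x \in S) ->
  (forall x y : core, x != y -> f x = f y -> adj x y) -> False.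
Proof.
move=> cardS fS fibers.
have ne x y : x != y :> core -> ~~ adj x y -> f x != f y.
  by move=> xy; apply: contra => /eqP; apply: fibers.
have f01 : f (v 0) != f (v 1) by apply: ne.
have f08 : f (v 0) != f (v 8) by apply: ne.
have f18 : f (v 1) != f (v 8) by apply: ne.
have third x : f x != f (v 0) -> f x != f (v 1) -> f x = f (v 8).
  by move=> *; apply: (third_value cardS) (f01) _ _ _ _.
have third1 x : f x != f (v 0) -> f x != f (v 8) -> f x = f (v 1).
  by move=> *; apply: (third_value cardS) (f08) _ _ _ _; rewrite // eq_sym.
have third0 x : f x != f (v 1) -> f x != f (v 8) -> f x = f (v 0).
  by move=> *; apply: (third_value cardS) (f18) _ _ _ _; rewrite // eq_sym.
(* As 2 and 1 are not adjacent, 2 has the colour of 0 or that of 8. In both cases no colour is left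
   for 9. *)
have [f2|f2] := eqVneq (f (v 2)) (f (v 0)).
  have f4 : f (v 4) = f (v 8) by apply: third; rewrite -?f2; apply: ne.
  have f7 : f (v 7) = f (v 1) by apply: third1; rewrite -?f2; apply: ne.
  have f6 : f (v 6) = f (v 0) by apply: third0; rewrite -?f7; apply: ne.
  have f5 : f (v 5) = f (v 8) by apply: third; rewrite -?f2 -?f7; apply: ne.
  have f3 : f (v 3) = f (v 1) by apply: third1; rewrite -?f6 -?f4; apply: ne.
  have : f (v 9) != f (v 8) by rewrite -f5; apply: ne.
  by rewrite third ?eqxx // -?f3; apply: ne.
have {}f2 : f (v 2) = f (v 8) by apply: third => //; apply: ne.
have f4 : f (v 4) = f (v 0) by apply: third0; rewrite -?f2; apply: ne.
have f6 : f (v 6) = f (v 1) by apply: third1; rewrite -?f4; apply: ne.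
have f7 : f (v 7) = f (v 0) by apply: third0; rewrite -?f6; apply: ne.
have f5 : f (v 5) = f (v 1) by apply: third1; rewrite -?f7 -?f2; apply: ne.
have f3 : f (v 3) = f (v 8) by apply: third; rewrite -?f4 -?f6; apply: ne.
have : f (v 9) != f (v 8) by rewrite -f3; apply: ne.
by rewrite third ?eqxx // -?f5; apply: ne.
Qed.

(** No row of [coneighbours] contains its own index, so [~~ coadj w u] puts [u] in the closed
    neighbourhood of [w]. Plain numbers keep the test fast to evaluate. *)
Definition dominates (s : seq nat) :=
  all (fun u => has (fun w => ~~ coadj w u) s) (iota 0 10).

Definition answered (s : seq nat) u :=
  (u \in s) || has (fun a => ~~ coadj a u && dominates (u :: rem a s)) s.

Lemma answeredP : all (fun a => all (fun b => all (fun c =>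
    uniq [:: a; b; c] ==> dominates [:: a; b; c] ==>
    all (answered [:: a; b; c]) (iota 0 10))
  (iota 0 10)) (iota 0 10)) (iota 0 10).
Proof. by vm_compute. Qed.

Lemma setU1_setD1_rem (T : finType) (s : seq T) a u :
  uniq s -> u |: [set x in s] :\ a = [set x in u :: rem a s].
Proof. by move=> uniq_s; apply/setP => x; rewrite !inE mem_rem_uniq. Qed.

Lemma rem_map (T U : eqType) (f : T -> U) a s :
  injective f -> rem (f a) (map f s) = map f (rem a s).
Proof.
by move=> f_inj; elim: s => //= b s ->; rewrite (inj_eq f_inj); case: eqP.
Qed.

(* Every dominating set of three vertices is a safe position of the guards. *)
Lemma core_guardable : guardable [set: core] 3.
Proof.
pose safe (D : {set core}) := exists s : seq core,
  [/\ uniq s, size s = 3, D = [set x in s] & dominates (map val s)].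
exists safe, [set x in [:: v 0; v 3; v 9]].
split; first by exists [:: v 0; v 3; v 9].
  by rewrite cardsE; apply/card_uniqP.
move=> D [s [uniq_s size_s -> dom_s]]; split=> [|u]; first exact: subsetT.
rewrite !inE andbT => us.
have in10 (x : 'I_10) : val x \in iota 0 10 by rewrite mem_iota /=.
have val_injc : injective (val : core -> nat) := val_inj.
have : answered (map val s) (val u).
  case: s size_s uniq_s dom_s {us} => [|a [|b [|c []]]] // _.
  rewrite -(map_inj_uniq val_injc) => uniq_s dom_s.
  have /implyP/(_ uniq_s)/implyP/(_ dom_s)/allP :=
    allP (allP (allP answeredP _ (in10 a)) _ (in10 b)) _ (in10 c).
  by apply.
rewrite /answered (mem_map val_injc) (negbTE us) /=.
case/hasP => _ /mapP[a a_s ->] /andP[au dom_u].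
exists a; split; first by rewrite inE.
  by rewrite /= /core_rel au andbT; apply: contraNneq us => <-.
exists (u :: rem a s); split.
- by rewrite /= rem_uniq // mem_rem_uniq // inE (negbTE us) andbF.
- by rewrite /= size_rem // size_s.
- exact: setU1_setD1_rem.
- by rewrite /= -rem_map.
Qed.

(** * The core with a pendant vertex and isolated vertices *)

Section Pendant.
Variable m : nat.

(* [inr ord0] is the vertex hung at 8; the other [inr j] are isolated. *)
Definition pendant_rel : rel ('I_10 + 'I_m.+1)%type := fun x y =>
  match x, y with
  | inl i, inl j => core_rel i j
  | inl i, inr j | inr j, inl i => (i == v 8) && (j == ord0)
  | inr _, inr _ => false
  end.

Lemma pendant_sym : symmetric pendant_rel.
Proof. by move=> [i|i] [j|j] //=; apply: core_sym. Qed.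

Lemma pendant_irrefl : irreflexive pendant_rel.
Proof. by move=> [i|i] //=; apply: core_irrefl. Qed.

Definition pendant := SGraph pendant_sym pendant_irrefl.

Definition prism := cartesian pendant (complete 2).

Definition s1 : seq core := [:: v 0; v 3; v 9].
Definition s2 : seq core := [:: v 1; v 2; v 4].
Definition s3 : seq core := [:: v 6; v 7; v 8].

Definition base_stable : {set pendant} :=
  [set x | if x is inl i then i \in s1 else true].

Lemma base_stable_independent : independent base_stable.
Proof.
apply/independentP => -[i|i] [j|j] //; rewrite !inE.
- by case/or3P => /eqP -> /or3P[] /eqP ->.
- by case/or3P => /eqP ->.
- by move=> _ /or3P[] /eqP ->.
Qed.

Lemma card_base_stable : #|base_stable| = m + 4.
Proof.
rewrite -sum1_card big_mkcond big_sumType /=.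
under eq_bigr do rewrite inE.
under [X in _ + X]eq_bigr do rewrite inE.
rewrite -big_mkcond !sum1_card card_ord (card_uniqP (isT : uniq s1)).
by rewrite addnC addSnnS.
Qed.

(** Three triangles cover the core without 8; the vertex 8 is paired with its pendant neighbour, and
    each isolated vertex stands alone. *)
Definition part (x : pendant) : 'I_3 + 'I_m.+1 :=
  match x with
  | inl i => if i \in [:: v 0; v 2; v 6] then inl (@Ordinal 3 0 isT)
      else if i \in [:: v 1; v 3; v 5] then inl (@Ordinal 3 1 isT)
      else if i \in [:: v 4; v 7; v 9] then inl (@Ordinal 3 2 isT)
      else inr ord0
  | inr j => inr j
  end.

Lemma part_clique t : clique [set x | part x == t].
Proof.
apply/cliqueP => x y; rewrite !inE => /eqP <-.
case: x y => [[i lti]|i] [[j ltj]|j].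
- by do 10?[case: i lti => [|i] lti //]; do 10?[case: j ltj => [|j] ltj //].
- by do 10?[case: i lti => [|i] lti //].
- by do 10?[case: j ltj => [|j] ltj //]; rewrite /= eq_sym.
by case/eqP => ->; rewrite eqxx.
Qed.

(** The set [base_stable] gives the lower bounds and the [m + 4] cliques of [part] the upper
    ones. *)
Lemma pendant_numbers :
  [/\ independence_number pendant = m + 4,
      eternal_domination_number pendant = m + 4
    & clique_cover_number pendant = m + 4].
Proof.
have card_parts : #|{: 'I_3 + 'I_m.+1}| = m + 4.
  by rewrite card_sum !card_ord addnC addSnnS.
have ge := independent_le base_stable_independent.
have ge_cover := independent_le_cover base_stable_independent.
have le := eternal_domination_number_clique_fibers part_clique.
have le_cover := clique_cover_number_fibers part_clique.
have mid := independence_le_eternal pendant.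
rewrite !card_base_stable !card_parts in ge ge_cover le le_cover.
split; apply/eqP; rewrite eqn_leq.
- by rewrite ge (leq_trans mid le).
- by rewrite le (leq_trans ge mid).
- by rewrite le_cover ge_cover.
Qed.

(** * The prism: guards, independent sets and clique covers *)

Definition layer (p : prism) : 'I_2 + 'I_m.+1 :=
  match p.1 with inl _ => inl p.2 | inr j => inr j end.

(** The fibers of [layer] are the two copies of the core and the edges above the vertices [inr j],
    for a total of 2 * 3 + (m + 1) = m + 7 guards. *)
Lemma layer_guardable t :
  guardable [set p | layer p == t] (if t is inl _ then 3 else 1).
Proof.
case: t => [c|j].
  pose e (i : core) : prism := (inl i, c).
  have -> : [set p | layer p == inl c] = e @: [set: core].
    apply/setP => -[x d]; rewrite !inE; apply/eqP/imsetP => [|[i _ [-> ->]]] //.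
    by case: x => // i [->]; exists i.
  apply: guardable_imset core_guardable; first by move=> i j [].
  by move=> i j; rewrite /= /cartesian_rel /= eqxx => ->; rewrite orbT.
have clX : clique [set p : prism | layer p == inr j].
  apply/cliqueP => -[[i|i] c] [[i'|i'] d]; rewrite !inE /layer //=.
  move=> /eqP[->] /eqP[->] cd; rewrite /cartesian_rel eqxx.
  by apply/orP; left; apply: contraNneq cd => /= ->.
have := guardable_clique clX.
suff -> : [set p : prism | layer p == inr j] != set0 by [].
by apply/set0Pn; exists (inr j, ord0); rewrite inE.
Qed.

Definition stable (s s' : seq core) (b : 'I_2) : {set prism} :=
  [set p | match p.1 with
           | inl i => i \in (if p.2 == ord0 then s else s')
           | inr _ => p.2 == b
           end].

Lemma card_stable s s' b :
  uniq s -> uniq s' -> #|stable s s' b| = m.+1 + (size s + size s').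
Proof.
move=> uniq_s uniq_s'.
have -> : #|stable s s' b| =
    \sum_(x : pendant) \sum_(c : 'I_2) if (x, c) \in stable s s' b then 1 else 0.
  by rewrite -sum1_card big_mkcond /= pair_bigA; apply: eq_bigr => -[].
rewrite big_sumType /= addnC; congr (_ + _).
  rewrite -[RHS](card_ord m.+1) -sum1_card; apply: eq_bigr => j _.
  by under eq_bigr do rewrite inE /=; rewrite -big_mkcond big_pred1_eq.
rewrite exchange_big [LHS]big_ord_recl big_ord1 /=.
congr (_ + _); under eq_bigr do rewrite inE /=;
  by rewrite -big_mkcond sum1_card; apply/card_uniqP.
Qed.

(** Disjointness of the two lists excludes the edges between the layers; the condition on 8 excludes
    the pendant edge in layer [b]. *)
Lemma stable_independent s s' b :
  allrel (fun i j => ~~ core_rel i j) s s ->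
  allrel (fun i j => ~~ core_rel i j) s' s' ->
  ~~ has (mem s) s' -> v 8 \notin (if b == ord0 then s else s') ->
  independent (stable s s' b).
Proof.
move=> /allrelP ind_s /allrelP ind_s' disj out8.
have ind (t : 'I_2) i j : i \in (if t == ord0 then s else s') ->
    j \in (if t == ord0 then s else s') -> ~~ core_rel i j.
  by case: ifP => _; [apply: ind_s | apply: ind_s'].
have inj (c d : 'I_2) i : i \in (if c == ord0 then s else s') ->
    i \in (if d == ord0 then s else s') -> c = d.
  move: c d => [[|[|//]] ltc] [[|[|//]] ltd] /= ic id; try exact: val_inj.
    by case/hasP: disj; exists i.
  by case/hasP: disj; exists i.
apply/independentP => -[x c] [y d]; rewrite !inE /=.
case: x y => [i|i] [j|j] /= ic jd; apply/negP => /orP[]/andP[/eqP /= eq1 eq2] //.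
- case: eq1 => eq_ij; rewrite -eq_ij in jd.
  by move: eq2; rewrite (inj c d i) // /complete_rel eqxx.
- by move: eq2; rewrite -eq1 in jd; apply/negP/(ind c).
- move: out8 ic; case/andP: eq2 => /eqP -> _; rewrite eq1 (eqP jd).
  by move/negbTE => ->.
- move: out8 jd; case/andP: eq2 => /eqP -> _; rewrite -eq1 (eqP ic).
  by move/negbTE => ->.
- by move: eq2; rewrite (eqP ic) (eqP jd) /complete_rel eqxx.
Qed.

Lemma prism_eternal : eternal_domination_number prism <= m + 7.
Proof.
apply: leq_trans (eternal_domination_number_fibers layer_guardable) _.
rewrite big_sumType /= !sum_nat_const !card_ord muln1.
by rewrite addnC addSn -addnS.
Qed.

Lemma stable_m7 s s' b :
  uniq s -> uniq s' -> size s = 3 -> size s' = 3 -> #|stable s s' b| = m + 7.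
Proof. by move=> us us' ss ss'; rewrite card_stable // ss ss' addSnnS. Qed.

Lemma prism_independence : m + 7 <= independence_number prism.
Proof.
rewrite -(@stable_m7 s1 s2 ord0) //; apply: independent_le.
exact: stable_independent.
Qed.

Lemma prism_cover : m + 7 < clique_cover_number prism.
Proof.
rewrite ltnNge; have [P coverP <-] := clique_cover_numberP prism; apply/negP => le_P.
pose b1 : 'I_2 := Ordinal (isT : 1 < 2).
have ind12 b : independent (stable s1 s2 b).
  by apply: stable_independent => //; case: ifP.
have ind13 : independent (stable s1 s3 ord0) by apply: stable_independent.
have tight s s' b : uniq s -> uniq s' -> size s = 3 -> size s' = 3 ->
    independent (stable s s' b) -> _ :=
  fun us us' ss ss' ind => tight_cover coverP ind
    (leq_trans le_P (eq_leq (esym (stable_m7 b us us' ss ss')))).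
have [meet12 uniq12] := tight s1 s2 ord0 isT isT erefl erefl (ind12 _).
have [meet12' _] := tight s1 s2 b1 isT isT erefl erefl (ind12 _).
have [meet13 _] := tight s1 s3 ord0 isT isT erefl erefl ind13.
have clP X : X \in P -> clique X by apply: clique_cover_clique.
have level X (x y : pendant) c d : X \in P -> (x, c) \in X -> (y, d) \in X ->
    x != y -> c = d.
  move=> /clP/cliqueP clX xX yX xy; have := clX _ _ xX yX.
  rewrite xpair_eqE (negbTE xy) => /(_ isT).
  by rewrite /= /cartesian_rel /= (negbTE xy) => /andP[/eqP].
(* [X] meets [stable s1 s2 b1]. A core vertex there would also lie, with [(inr j, ord0)], in the
   independent set [stable s1 s2 ord0]. So [X] has a vertex [(inr j', b1)], and [level] would put
   [(inl i, c)] in both layers. *)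
have column X i j c : X \in P -> (inr j, ord0) \in X -> (inl i, c) \notin X.
  move=> XP jX; apply/negP => iX; have [[x d] + wX] := meet12' X XP.
  rewrite inE /=; case: x wX => [h|j'] wX.
    move=> hs; have hW : (inl h, d) \in stable s1 s2 ord0 by rewrite inE.
    have jW : (inr j, ord0) \in stable s1 s2 ord0 by rewrite inE.
    by have := independent_clique_eq (ind12 ord0) (clP X XP) hW jW wX jX.
  move/eqP => db; move: wX; rewrite db => wX.
  have := level _ _ _ _ _ XP wX iX isT.
  by rewrite -(level _ _ _ _ _ XP jX iX isT).
(* By [level], the only core vertex that [X] can have in the upper layer is the one above [i]. If
   [X] missed [s1] below, meeting both stable sets would force [i] into both [s2] and [s3], which
   are disjoint. *)
have bottom X i : X \in P -> (inl i, ord0) \in X ->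
    exists h, h \in s1 /\ (inl h, ord0) \in X.
  move=> XP iX.
  have sameE (h : core) d : (inl h, d) \in X -> d != ord0 -> h = i.
    move=> hX; apply: contraNeq => hi; apply/eqP.
    exact: (level _ _ _ _ _ XP hX iX).
  have [[[h|j] d] + wX] := meet12 X XP; rewrite inE /=; last first.
    by move/eqP => d0; move: wX; rewrite d0 => /(column X i j ord0 XP); rewrite iX.
  case: eqP => [d0|/eqP d0] hs; first by exists h; rewrite -d0.
  have [[[h'|j] d'] + wX'] := meet13 X XP; rewrite inE /=; last first.
    by move/eqP => d'0; move: wX'; rewrite d'0 => /(column X i j ord0 XP); rewrite iX.
  case: eqP => [d'0|/eqP d'0] hs'; first by exists h'; rewrite -d'0.
  move: hs hs'; rewrite (sameE _ _ wX d0) (sameE _ _ wX' d'0) !inE.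
  by case/or3P => /eqP ->.
have [c cP] := clique_cover_choice coverP.
have /choice[f fP] i : exists h, h \in s1 /\ (inl h, ord0) \in c (inl i, ord0).
  by have [cP1 cP2] := cP (inl i, ord0); apply: bottom cP1 cP2.
(* The colour of [i] is a vertex of [s1] in the clique chosen for [(inl i, ord0)]. By [uniq12],
   vertices of equal colour share their clique, so they are adjacent when distinct. *)
apply: (@core_not_3_coverable _ [set x in s1] f).
- by rewrite cardsE (card_uniqP (isT : uniq s1)).
- by move=> i; rewrite inE; case: (fP i).
move=> i j ij eq_f; have [cPi ci] := cP (inl i, ord0).
have [cPj cj] := cP (inl j, ord0).
have [fi1 fi] := fP i; have [_ fj] := fP j.
have cE : c (inl i, ord0) = c (inl j, ord0).
  apply: (uniq12 _ _ (inl (f i), ord0)) => //; first by rewrite inE.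
  by rewrite eq_f.
rewrite -cE in cj; have := cliqueP _ (clP _ cPi) _ _ ci cj.
rewrite xpair_eqE andbT -[inl i == _]/(i == j) => /(_ ij).
by rewrite /= /cartesian_rel /= -[inl i == _]/(i == j) (negbTE ij).
Qed.

Lemma prism_numbers :
  independence_number prism = eternal_domination_number prism /\
  eternal_domination_number prism < clique_cover_number prism.
Proof.
split; last exact: leq_ltn_trans prism_eternal prism_cover.
apply/eqP; rewrite eqn_leq independence_le_eternal.
exact: leq_trans prism_eternal prism_independence.
Qed.

End Pendant.

Theorem theorem9 (k : nat) (hk : 2 <= k) :
  exists G : sgraph,
    [/\ independence_number G = eternal_domination_number G,
        eternal_domination_number G = clique_cover_number G
      & clique_cover_number G = 'C(k.+1, 2) + 1] /\
    independence_number (cartesian G (complete 2)) =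
      eternal_domination_number (cartesian G (complete 2)) /\
    eternal_domination_number (cartesian G (complete 2)) <
      clique_cover_number (cartesian G (complete 2)).
Proof.
(* The parameter [m] must satisfy m + 4 = 'C(k.+1, 2) + 1; this bound keeps the subtraction of 3
   from truncating. *)
have ge3 : 3 <= 'C(k.+1, 2) by rewrite -[3]/('C(3, 2)) leq_bin2l.
have [alphaE gammaE thetaE] := pendant_numbers ('C(k.+1, 2) - 3).
exists (pendant ('C(k.+1, 2) - 3)); split; last exact: prism_numbers.
by rewrite alphaE gammaE thetaE -[4]/(3 + 1) addnA subnK.
Qed.
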